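(* Let $\rho>0$, let $L\ge 1$ be an integer, and set $\sigma_E^2=\frac{1}{1+\rho L}$, $\sigma_E=\sqrt{\sigma_E^2}$. Consider a single access point ($A=1$). Let $h=\hat h+\tilde h$, where $\hat h\sim\mathcal{CN}(0,1-\sigma_E^2)$ and $\tilde h\sim\mathcal{CN}(0,\sigma_E^2)$ are independent, and let $W>0$, $C=W\log_2(1+\rho|h|^2)$, $R=W\log_2(1+\rho|\hat h|^2)$. Then the probability of device failure is $$\mathbb{P}[R>C]=\frac12\left(1-\frac{\sigma_E}{\sqrt{4-3\sigma_E^2}}\right).$$
   Context: $\mathcal{CN}(0,s)$ denotes the circularly symmetric complex Gaussian distribution with mean $0$ and variance $s$ (so $X\sim\mathcal{CN}(0,s)$ has $\mathbb{E}|X|^2=s$). Here $h$ is a Rayleigh fading channel, $\hat h$ its MMSE estimate from $L$ pilots, $\tilde h$ the estimation error, $\rho$ the average received SNR, $C$ the mutual information of the channel over bandwidth $W$, and $R$ the transmission rate selected from the channel estimate. Device failure is the event $\{R>C\}$. *)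

(* Defs.v *)
From HB Require Import structures.
From mathcomp Require Import all_boot all_order all_algebra.
From mathcomp Require Import all_classical all_reals all_analysis.
From mathcomp Require Export complex.

Set Implicit Arguments.
Unset Strict Implicit.
Unset Printing Implicit Defensive.

Import Order.TTheory GRing.Theory Num.Theory.

Local Open Scope classical_set_scope.
Local Open Scope ring_scope.

(* The Borel sigma-algebra of the complex plane, generated, as for R * R, by
   the two coordinates. *)
Section complex_measurable.
Variable R : realType.

Definition complex_display : measure_display.
Proof. exact. Qed.

HB.instance Definition _ := isPointed.Build R[i] 0.

Let complex_measurable : set (set R[i]) :=
  g_sigma_preimageU (@complex.Re R) (@complex.Im R).

Let complex_measurable0 : complex_measurable set0.
Proof. exact: sigma_algebra0. Qed.

Let complex_measurableC A :
  complex_measurable A -> complex_measurable (~` A).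
Proof. exact: sigma_algebraC. Qed.

Let complex_measurable_bigcup (F : (set R[i])^nat) :
  (forall i, complex_measurable (F i)) ->
  complex_measurable (\bigcup_i (F i)).
Proof. exact: sigma_algebra_bigcup. Qed.

HB.instance Definition _ := @isMeasurable.Build complex_display R[i]
  complex_measurable complex_measurable0 complex_measurableC
  complex_measurable_bigcup.

End complex_measurable.

Section gaussian.
Context d (T : measurableType d) (R : realType) (P : probability T R).

Definition independent d1 d2 (T1 : measurableType d1) (T2 : measurableType d2)
    (X : T -> T1) (Y : T -> T2) : Prop :=
  forall A B, measurable A -> measurable B ->
    P (X @^-1` A `&` Y @^-1` B) = (P (X @^-1` A) * P (Y @^-1` B))%E.

(* [v] is the variance, whereas [normal_prob] takes the standard deviation and
   is the uniform law on [0, 1] when that is 0. *)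
Definition is_normal (m v : R) (X : T -> R) : Prop :=
  0 <= v /\
  forall A, measurable A ->
    P (X @^-1` A) = if v == 0 then \d_m A else normal_prob m (Num.sqrt v) A.

(* CN(0, s): the real and imaginary parts are independent and each N(0, s/2),
   so that E|X|^2 = s. *)
Definition is_complex_normal (s : R) (X : {RV P >-> R[i]}) : Prop :=
  [/\ is_normal 0 (s / 2) (fun t => complex.Re (X t)),
      is_normal 0 (s / 2) (fun t => complex.Im (X t)) &
      independent (fun t => complex.Re (X t)) (fun t => complex.Im (X t))].

End gaussian.

Definition log2 (R : realType) (x : R) : R := ln x / ln 2.

(* Main.v *)
Require Import Defs.
From HB Require Import structures.
From mathcomp Require Import all_boot all_order all_algebra.
From mathcomp Require Import all_classical all_reals all_analysis.
From mathcomp Require Import measurable_realfun ring lra.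

(* Write x and y for the planar vectors of hhat and htilde, whose coordinates
   have standard deviations sx and sy. Failure |x + y| < |x| means
   2 x.y + |y|^2 < 0. Given y <> 0, x.y is centred normal with standard
   deviation |y| sx, so failure has the conditional probability that a centred
   normal z with standard deviation sx satisfies z < - |y| / 2, that is z < 0
   and |y|^2 < 4 z^2. Now exchange the roles: given z, the complementary
   condition |y|^2 >= 4 z^2 has probability exp (- 4 z^2 / (2 sy^2)), and
   integrating this against the density of z over z < 0 is a half-line
   Gaussian integral. *)

Import Order.TTheory GRing.Theory Num.Theory.
Import numFieldNormedType.Exports.

Local Open Scope classical_set_scope.
Local Open Scope ring_scope.

(** * Integration against a measure given by a density *)

Section density.
Local Open Scope ereal_scope.
Import HBNNSimple.
Context d (T : measurableType d) (R : realType).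
Variables (mu nu : {measure set T -> \bar R}) (g : T -> R).
Hypotheses (mg : measurable_fun [set: T] g) (g0 : forall x, (0 <= g x)%R).
Hypothesis nuE : forall A, measurable A -> nu A = \int[mu]_(x in A) (g x)%:E.

Let mgE : measurable_fun [set: T] (fun x => (g x)%:E).
Proof. exact/measurable_EFinP. Qed.

(** Monotone convergence on both sides reduces the claim to the simple approximations [h n]; these
    split over their values into indicators, for which it is [nuE]. *)
Lemma ge0_integral_density (f : T -> \bar R) :
  measurable_fun [set: T] f -> (forall x, 0 <= f x) ->
  \int[nu]_x f x = \int[mu]_x (f x * (g x)%:E).
Proof.
move=> mf f0.
pose h := nnsfun_approx measurableT mf.
have cvh x : EFin (h n x) @[n --> \oo] --> f x.
  by apply: cvg_nnsfun_approx => // y _; exact: f0.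
have ndh x : {homo (fun n => (h n x)%:E) : m n / (m <= n)%N >-> m <= n}.
  by move=> a b ab; rewrite lee_fin; exact/lefP/nd_nnsfun_approx.
transitivity (limn (fun n => \int[nu]_x (h n x)%:E)).
  rewrite -monotone_convergence//.
  - by apply: eq_integral => x _; apply/esym/cvg_lim.
  - by move=> n; exact/measurable_EFinP/measurable_funP.
  - by move=> n x _; rewrite lee_fin.
have mhg n : measurable_fun [set: T] (fun x => (h n x)%:E * (g x)%:E).
  by apply: emeasurable_funM => //; exact/measurable_EFinP/measurable_funP.
transitivity (limn (fun n => \int[mu]_x ((h n x)%:E * (g x)%:E))); last first.
  rewrite -monotone_convergence//.
  - apply: eq_integral => x _; apply/cvg_lim => //.
    by apply: cvgeZr => //.
  - by move=> n x _; rewrite mule_ge0// lee_fin.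
  - by move=> x _ a b ab; rewrite lee_wpmul2r ?lee_fin//; exact: ndh.
congr (limn _); apply/funext => n.
under eq_integral do rewrite fimfunE -fsumEFin//.
rewrite ge0_integral_fsum//; last 2 first.
- by move=> r; exact/measurable_EFinP/measurable_funM.
- by move=> r x _; rewrite nnfun_muleindic_ge0.
rewrite [RHS](eq_integral (fun x => \sum_(r \in range (h n))
    ((r * \1_(h n @^-1` [set r]) x)%:E * (g x)%:E))); last first.
  move=> x _; rewrite [in LHS]fimfunE -fsumEFin// ge0_mule_fsuml// => r.
  by rewrite nnfun_muleindic_ge0.
rewrite ge0_integral_fsum//; last 2 first.
- move=> r; apply: emeasurable_funM => //.
  exact/measurable_EFinP/measurable_funM.
- by move=> r x _; rewrite mule_ge0 ?nnfun_muleindic_ge0// lee_fin.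
apply: eq_fsbigr => r _; rewrite integralZl_indic_nnsfun// integral_indic//.
rewrite setIT nuE//.
(* Pulling the scalar [r] out needs [0 <= r]; a negative [r] is never a value of [h n], so both
   sides vanish. *)
have [r0|r0] := ltP r 0%R.
  by rewrite preimage_nnfun0// integral_set0 mule0; apply/esym/integral0_eq;
    move=> x _; rewrite indicE in_set0 mulr0 mul0e.
under [RHS]eq_integral do rewrite EFinM -muleA.
rewrite ge0_integralZl//; last 2 first.
- by apply: emeasurable_funM => //; exact/measurable_EFinP.
- by move=> x _; rewrite mule_ge0 ?lee_fin.
congr (_ * _); rewrite integral_mkcond; apply: eq_integral => x _.
by rewrite patchE indicE; case: ifP => _; rewrite ?mul1e ?mul0e.
Qed.

End density.

(** * Affine substitution in Lebesgue integrals on the line *)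

Section affine_change_of_variables.
Local Open Scope ereal_scope.
Context (R : realType).
Local Notation mu := (@lebesgue_measure R).

Let affine (k b : R) (x : measurableTypeR R) : measurableTypeR R :=
  (k * x + b)%R.

Let measurable_affine (k b : R) :
  measurable_fun [set: measurableTypeR R] (affine k b).
Proof. by apply: measurable_funD => //; exact: measurable_funM. Qed.

(** The right-hand side is itself a measure in [A], the rescaled image [m] of [mu]; it gives
    half-open intervals their length, which determines Lebesgue measure. *)
Let lebesgue_measure_affine (k b : R) (A : set R) : (0 < k)%R ->
  measurable A -> mu A = k%:E * mu (affine k b @^-1` A).
Proof.
move=> k0 mA.
pose m := mscale (NngNum (ltW k0)) (pushforward mu (affine k b)) :
  {measure set (measurableTypeR R) -> \bar R}.
transitivity (m (measurable_affine k b) A) => //.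
apply: lebesgue_measure_unique => // _ [[u v]] _ <-.
rewrite [RHS]/(k%:E * mu (affine k b @^-1` [set` `]u, v]%R])).
have -> : affine k b @^-1` [set` `]u, v]%R] =
    [set` `](u - b) / k, (v - b) / k]%R].
  apply/seteqP; split => x /=; rewrite /affine !in_itv/= ltr_pdivrMr//
    ler_pdivlMr// ltrBlDr lerBrDr mulrC//.
rewrite !lebesgue_measure_itv/= !lte_fin ltr_pM2r ?invr_gt0// ltrD2r.
have [_|_] := ltP u v; last by rewrite /= mulr0.
by congr EFin; field; rewrite gt_eqF.
Qed.

(** A positive slope is handled by a scaled pushforward; a negative one is first reflected, and then
    the positive case applies with [- k] and [- b]. *)
Lemma ge0_integral_affine (k b : R) (f : R -> \bar R) : k != 0%R ->
  measurable_fun [set: R] f -> (forall x, 0 <= f x) ->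
  \int[mu]_x f x = `|k|%:E * \int[mu]_x f (k * x + b)%R.
Proof.
have pos (k' b' : R) (f' : R -> \bar R) : (0 < k')%R ->
    measurable_fun [set: R] f' -> (forall x, 0 <= f' x) ->
    \int[mu]_x f' x = k'%:E * \int[mu]_x f' (k' * x + b')%R.
  move=> k0 mf f0.
  have /= <- := @ge0_integral_pushforward _ _ _ _ _ _ (measurable_affine k' b')
    mu setT f' measurableT mf (fun y _ => f0 y).
  pose m := pushforward mu (affine k' b') :
    {measure set (measurableTypeR R) -> \bar R}.
  have /= <- := @ge0_integral_mscale _ _ _ (m (measurable_affine k' b')) setT
    measurableT (NngNum (ltW k0)) f' mf (fun y _ => f0 y).
  apply: eq_measure_integral => A mA _.
  exact: lebesgue_measure_affine _ b' _ k0 mA.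
move=> k0 mf f0; have [k_lt0|k_gt0|/eqP] := ltgtP k 0%R; last first.
- by rewrite (negPf k0).
- by rewrite gtr0_norm//; exact: pos.
rewrite ltr0_norm//.
have mN : measurable_fun [set: measurableTypeR R]
  (-%R : measurableTypeR R -> measurableTypeR R) by [].
transitivity (\int[mu]_x f (- x)%R).
  have /= <- := @ge0_integral_pushforward _ _ _ _ _ _ mN
    mu setT f measurableT mf (fun y _ => f0 y).
  by apply: eq_measure_integral => A mA _; exact/esym/lebesgue_measureN.
rewrite (pos (- k)%R (- b)%R) ?oppr_gt0//; last exact: measurableT_comp.
congr (_ * _).
by apply: eq_integral => x _; congr f; ring.
Qed.

End affine_change_of_variables.

(** * Affine images, linear combinations and symmetry of normal laws *)

Section normal_prob_lemmas.
Context (R : realType).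
Local Notation mu := (@lebesgue_measure R).
Implicit Types (m s k b u v x : R) (A : set R).

Lemma integral_normal_prob m s (f : R -> \bar R) :
  measurable_fun [set: R] f -> (forall x, 0 <= f x)%E ->
  (\int[normal_prob m s]_x f x = \int[mu]_x (f x * (normal_pdf m s x)%:E))%E.
Proof.
move=> mf f0; apply: (@ge0_integral_density _ _ _ mu) => //.
- exact: measurable_normal_pdf.
- by move=> x; exact: normal_pdf_ge0.
Qed.

Lemma normal_probE m s A :
  normal_prob m s A = (\int[mu]_x ((normal_pdf m s x)%:E * (\1_A x)%:E))%E.
Proof. by rewrite /normal_prob integral_mkcond epatch_indic. Qed.

Lemma normal_peakM k s : k != 0 -> `|k| * normal_peak (k * s) = normal_peak s.
Proof.
move=> k0; rewrite /normal_peak exprMn -mulrA -mulrnAr sqrtrM ?sqr_ge0//.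
by rewrite sqrtr_sqr invfM mulrA divff ?mul1r// normr_eq0.
Qed.

Lemma normal_pdf_affine m s k b x : k != 0 -> s != 0 ->
  `|k| * normal_pdf (k * m + b) (k * s) (k * x + b) = normal_pdf m s x.
Proof.
move=> k0 s0; rewrite !normal_pdfE ?mulf_neq0// mulrA normal_peakM//.
congr (_ * expR _); field.
by rewrite s0 k0.
Qed.

(** Substitution in the density. The parameter [k * s] may be negative, which is harmless because
    the density depends only on its square. *)
Lemma normal_prob_affine m s k b A : k != 0 -> s != 0 -> measurable A ->
  normal_prob m s [set x | A (k * x + b)] = normal_prob (k * m + b) (k * s) A.
Proof.
move=> k0 s0 mA; rewrite !normal_probE.
rewrite [RHS](@ge0_integral_affine _ k b)//; last 2 first.
- apply/measurable_EFinP/measurable_funM; first exact: measurable_normal_pdf.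
  exact: measurable_indic.
- by move=> x; rewrite mule_ge0// lee_fin ?normal_pdf_ge0.
rewrite -ge0_integralZl//; last 2 first.
- apply/measurable_EFinP/measurable_funM => /=.
    apply: measurableT_comp; first exact: measurable_normal_pdf.
    by apply: measurable_funD => //; exact: measurable_funM.
  apply: measurableT_comp; first exact: measurable_indic.
  by apply: measurable_funD => //; exact: measurable_funM.
- by move=> x _; rewrite mule_ge0// lee_fin ?normal_pdf_ge0.
apply: eq_integral => x _; by rewrite -!EFinM mulrA normal_pdf_affine//.
Qed.

(* Completing the square in [v]. *)
Lemma normal_pdf_mul s k1 k2 u v : s != 0 -> k2 != 0 ->
  let r := Num.sqrt (k1 ^+ 2 + k2 ^+ 2) in
  normal_pdf (k1 * v) (k2 * s) u * normal_pdf 0 s v =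
  normal_pdf 0 (r * s) u * normal_pdf (k1 * u / r ^+ 2) (k2 * s / r) v.
Proof.
move=> s0 k20 r.
have k2_gt0 : 0 < k2 ^+ 2 by rewrite exprn_even_gt0.
have q0 : 0 < k1 ^+ 2 + k2 ^+ 2 by rewrite ltr_wpDl ?sqr_ge0.
have r_gt0 : 0 < r by rewrite sqrtr_gt0.
have r0 : r != 0 by rewrite gt_eqF.
have r2 : r ^+ 2 = k1 ^+ 2 + k2 ^+ 2 by rewrite sqr_sqrtr ?ltW.
rewrite !normal_pdfE ?mulf_neq0 ?invr_eq0//.
rewrite mulrACA [RHS]mulrACA /normal_fun -!expRD; congr (_ * expR _).
  (* The normalising constants match because the factor [r] gained by one deviation is lost by the
     other. *)
  rewrite -(@normal_peakM r s) // -(@normal_peakM r (k2 * s / r))//.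
  have -> : r * (k2 * s / r) = k2 * s by field.
  by ring.
rewrite !exprMn exprVn r2; field.
by rewrite s0 k20 gt_eqF.
Qed.

(** Given the first coordinate [v], the combination is normal with mean [k1 * v] and deviation
    [k2 * s]. After exchanging the integrals, completing the square leaves a normal density in [v],
    which integrates to 1. *)
Lemma normal_prob_lincomb s k1 k2 A : s != 0 -> k2 != 0 -> measurable A ->
  (normal_prob 0 s \x normal_prob 0 s)%E [set x | A (k1 * x.1 + k2 * x.2)] =
  normal_prob 0 (Num.sqrt (k1 ^+ 2 + k2 ^+ 2) * s) A.
Proof.
move=> s0 k20 mA; set r := Num.sqrt _.
have mlin : measurable_fun [set: R * R] (fun x : R * R => k1 * x.1 + k2 * x.2).
  by apply: measurable_funD; apply: measurable_funM.
have mS : measurable [set x : R * R | A (k1 * x.1 + k2 * x.2)].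
  by rewrite -[X in measurable X]setTI; exact: mlin.
have q0 : 0 < k1 ^+ 2 + k2 ^+ 2.
  by rewrite ltr_wpDl ?sqr_ge0// exprn_even_gt0.
have r0 : r != 0 by rewrite gt_eqF// sqrtr_gt0.
rewrite /product_measure1 integral_normal_prob//; last first.
  exact: measurable_fun_xsection.
(* The joint density of the first coordinate and the linear combination, restricted to values of the
   latter in [A]. *)
pose f (z : R * R) := ((normal_pdf (k1 * z.1) (k2 * s) z.2)%:E *
  (\1_A z.2)%:E * (normal_pdf 0 s z.1)%:E)%E.
have f0 z : (0 <= f z)%E by rewrite !mule_ge0// lee_fin ?normal_pdf_ge0.
have mf : measurable_fun [set: R * R] f.
  apply/measurable_EFinP; apply: measurable_funM; first apply: measurable_funM.
  - under eq_fun do rewrite normal_pdfE ?mulf_neq0//.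
    apply: measurable_funM => //; apply: measurableT_comp => //.
    apply: measurable_funM => //; apply: measurableT_comp => //.
    apply: measurable_funX; apply: measurable_funB => //.
    exact: measurable_funM.
  - by apply: measurableT_comp => //; exact: measurable_indic.
  - apply: measurableT_comp => //; exact: measurable_normal_pdf.
transitivity (\int[mu]_v \int[mu]_u f (v, u))%E.
  apply: eq_integral => v _ /=.
  have -> : xsection [set x : R * R | A (k1 * x.1 + k2 * x.2)] v =
      [set x | A (k2 * x + k1 * v)].
    by apply/seteqP; split => x; rewrite /xsection/= inE/= addrC.
  rewrite normal_prob_affine// mulr0 add0r normal_probE -ge0_integralZr//.
  - apply/measurable_EFinP/measurable_funM; first exact: measurable_normal_pdf.
    exact: measurable_indic.
  - by move=> x _; rewrite mule_ge0// lee_fin ?normal_pdf_ge0.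
  - by rewrite lee_fin normal_pdf_ge0.
rewrite fubini_tonelli// normal_probE; apply: eq_integral => u _.
transitivity (\int[mu]_v ((normal_pdf 0 (r * s) u)%:E * (\1_A u)%:E *
    (normal_pdf (k1 * u / r ^+ 2) (k2 * s / r) v)%:E))%E.
  apply: eq_integral => v _; rewrite /f -!EFinM; congr EFin.
  by rewrite mulrAC normal_pdf_mul// mulrAC.
rewrite ge0_integralZl//; last 3 first.
- by apply/measurable_EFinP; exact: measurable_normal_pdf.
- by move=> x _; rewrite lee_fin normal_pdf_ge0.
- by rewrite mule_ge0// lee_fin normal_pdf_ge0.
by rewrite integral_normal_pdf mule1.
Qed.

Lemma normal_probN m s : normal_prob m (- s) = normal_prob m s.
Proof.
suff E : normal_pdf m (- s) = normal_pdf m s by rewrite /normal_prob E.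
apply/funext => x.
by rewrite /normal_pdf oppr_eq0 /normal_peak /normal_fun sqrrN.
Qed.

Lemma normal_prob_set1 m s x : normal_prob m s [set x] = 0%E.
Proof.
have /null_content_dominatesP dom := normal_prob_dominates m s.
by apply: dom => //; exact: lebesgue_measure_set1.
Qed.

(** Reflection gives the two open half-lines equal mass, and the point 0 has none. *)
Lemma normal_prob_lt0 s : s != 0 ->
  normal_prob 0 s [set x | x < 0] = (1 / 2)%:E.
Proof.
move=> s0.
have mlt : measurable [set x : R | x < 0] by rewrite -set_itvNyo.
have mgt : measurable [set x : R | 0 < x] by rewrite -set_itvoy.
have Egt : normal_prob 0 s [set x | 0 < x] = normal_prob 0 s [set x | x < 0].
  have := @normal_prob_affine 0 s (-1) 0 [set x | x < 0].
  rewrite mulr0 addr0 mulN1r normal_probN => <- //.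
  by congr normal_prob; apply/seteqP; split => x /=;
    rewrite mulN1r addr0 oppr_lt0.
have : normal_prob 0 s [set: R] = 1%E by exact: probability_setT.
have -> : [set: R] = ([set x | x < 0] `|` [set x | 0 < x]) `|` [set 0].
  apply/seteqP; split => x //= _.
  by case: (ltgtP x 0) => [|| ->]; [left; left|left; right|right].
rewrite measureU//; last 2 first.
- exact: measurableU.
- by apply/seteqP; split => x //= [[] + x0]; rewrite x0 ltxx.
rewrite [X in (_ + X)%E](normal_prob_set1 0 s 0) adde0.
rewrite measureU//; last first.
  by apply/seteqP; split => x //= [/lt_trans /[apply]]; rewrite ltxx.
have /fineK := fin_num_measure (normal_prob 0 s) _ mlt.
set p := fine _ => pE; rewrite -pE in Egt *.
rewrite [X in (X + _)%E](esym pE) [X in (_ + X)%E]Egt -EFinD => -[E].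
by congr EFin; lra.
Qed.

End normal_prob_lemmas.

(** * Plane integrals of radial functions *)

Section radial_integral.
Local Open Scope ereal_scope.
Context (R : realType).
Local Notation mu := (@lebesgue_measure R).

(* Polar coordinates with the slope [t = y / x] instead of the angle. *)
Lemma ge0_integral_radial (g : R -> \bar R) :
  measurable_fun [set: R] g -> (forall x, 0 <= g x) ->
  \int[mu]_x \int[mu]_y g (x ^+ 2 + y ^+ 2)%R =
  (\int[mu]_w (`|w|%:E * g (w ^+ 2)%R)) * \int[mu]_t ((1 + t ^+ 2)^-1)%:E.
Proof.
move=> mg g0.
have mgsum : measurable_fun [set: R * R]
    (fun z : R * R => g (z.1 ^+ 2 + z.2 ^+ 2)%R).
  apply: (measurableT_comp mg).
  by apply: measurable_funD; apply: measurable_funX.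
pose f (z : R * R) := `|z.1|%:E * g (z.1 ^+ 2 * (1 + z.2 ^+ 2))%R.
have f0 z : 0 <= f z by rewrite mule_ge0// lee_fin.
have mf : measurable_fun [set: R * R] f.
  apply: emeasurable_funM; first exact/measurable_EFinP/measurableT_comp.
  apply: (measurableT_comp mg); apply: measurable_funM.
    exact: measurable_funX.
  by apply: measurable_funD => //; apply: measurable_funX.
have mft (t : R) : measurable_fun [set: R] (fun x => f (x, t)).
  apply: emeasurable_funM; first exact/measurable_EFinP.
  by apply: (measurableT_comp mg); apply: measurable_funM => //=.
have mw : measurable_fun [set: R] (fun w : R => `|w|%:E * g (w ^+ 2)%R).
  by apply: emeasurable_funM; [exact/measurable_EFinP|exact: measurableT_comp].
have mJ : measurable_fun [set: R] (fun t : R => (1 + t ^+ 2)^-1)%R.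
  exact: (continuous_measurable_fun (@continuous_oneDsqrV R)).
have mF1 := @measurable_fun_fubini_tonelli_F _ _ _ _ _ mu _ mgsum
  (fun z => g0 _).
have mF2 := @measurable_fun_fubini_tonelli_F _ _ _ _ _ mu _ mf f0.
(* The substitution [y = x * t] in the inner integral has Jacobian [|x|] and breaks down only at
   [x = 0], a null set. *)
transitivity (\int[mu]_x \int[mu]_t f (x, t)).
  apply: ge0_ae_eq_integral => //.
  - by move=> x _; exact: integral_ge0.
  - by move=> x _; exact: integral_ge0.
  exists [set 0%R]; split => //; first exact: lebesgue_measure_set1.
  move=> x /= /not_implyP[_]; apply: contra_notP => /eqP x0.
  have sqrE (t : R) : (x ^+ 2 + (x * t + 0) ^+ 2 = x ^+ 2 * (1 + t ^+ 2))%R.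
    by ring.
  rewrite (@ge0_integral_affine _ x 0)//; last first.
    apply: (measurableT_comp mg); exact: measurable_funD.
  rewrite -ge0_integralZl//; last first.
    apply: (measurableT_comp mg); apply: measurable_funD => //.
    by apply: measurable_funX; apply: measurable_funD.
  by apply: eq_integral => t _; rewrite /f/= sqrE.
rewrite fubini_tonelli// -ge0_integralZl//; last 3 first.
- exact/measurable_EFinP.
- by move=> t _; rewrite lee_fin invr_ge0 addr_ge0 ?sqr_ge0.
- by apply: integral_ge0 => w _; rewrite mule_ge0// lee_fin.
apply: eq_integral => t _.
have t1 : (0 < 1 + t ^+ 2)%R by rewrite ltr_pwDl ?sqr_ge0.
(* Setting [x = c * w] turns [x ^+ 2 * (1 + t ^+ 2)] into [w ^+ 2]. One factor [c] comes from the
   Jacobian and one from [|x|], whence [c ^+ 2 = (1 + t ^+ 2)^-1]. *)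
pose c : R := (Num.sqrt (1 + t ^+ 2))^-1%R.
have c0 : (0 < c)%R by rewrite invr_gt0 sqrtr_gt0.
have c2 : (c ^+ 2 = (1 + t ^+ 2)^-1)%R by rewrite exprVn sqr_sqrtr ?ltW.
rewrite [LHS](@ge0_integral_affine _ c 0) ?gt_eqF//.
rewrite -c2 expr2 EFinM [RHS]muleC -muleA gtr0_norm//; congr (_ * _).
rewrite -[RHS]ge0_integralZl//; last 2 first.
- by move=> w _; rewrite mule_ge0// lee_fin.
- by rewrite lee_fin ltW.
apply: eq_integral => w _; rewrite /f/= addr0 muleA -EFinM normrM.
by rewrite (gtr0_norm c0) exprMn mulrAC c2 mulVf ?mul1r// gt_eqF.
Qed.

End radial_integral.

(** * The law of the squared radius of a planar Gaussian vector *)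

Section gaussian_radius.
Context (R : realType).
Local Notation mu := (@lebesgue_measure R).
Implicit Types s u v w : R.

(** The integrand has the antiderivative [F], which tends to 0 at infinity, so only [- F a]
    remains. *)
Lemma integral_Mexp_sqr (s a : R) : s != 0 -> 0 <= a ->
  (\int[mu]_(w in `[a, +oo[) (w * expR (- w ^+ 2 / (s ^+ 2 *+ 2)))%:E =
   (s ^+ 2 * expR (- a ^+ 2 / (s ^+ 2 *+ 2)))%:E)%E.
Proof.
move=> s0 a0; set k := (s ^+ 2 *+ 2)^-1.
have s2 : 0 < s ^+ 2 by rewrite exprn_even_gt0.
have k0 : 0 < k by rewrite invr_gt0 pmulrn_lgt0.
pose F (w : R) := - (s ^+ 2 * expR (- w ^+ 2 * k)).
have dF (w : R) : is_derive w 1 F (w * expR (- w ^+ 2 * k)).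
  apply: is_derive_eq.
  rewrite !scaler0 !add0r /GRing.scale/= /k; field.
  by [].
have cF : continuous F.
  by move=> w; apply/differentiable_continuous/derivable1_diffP.
have F0 : F w @[w --> +oo] --> (0 : R).
  rewrite -[X in _ --> X]oppr0; apply: cvgN.
  rewrite -[X in _ --> X](mulr0 (s ^+ 2)); apply: cvgM; first exact: cvg_cst.
  under eq_fun do rewrite mulNr.
  apply: (cvg_comp (fun w : R => w ^+ 2 * k) (fun w => expR (- w))).
    by apply: gt0_cvgMly => //; exact: cvgr_expr2.
  exact: cvgr_expR.
rewrite (@ge0_continuous_FTC2y _ _ F a 0).
- by rewrite sub0e /F -EFinN opprK.
- by move=> x ax; rewrite mulr_ge0 ?expR_ge0// (le_trans a0).
- apply: continuous_subspaceT => x.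
  apply: cvgM; first exact: cvg_id.
  apply: (@continuous_comp _ _ _ (fun w : R => - w ^+ 2 * k) expR).
    by apply: cvgM; [apply: cvgN; exact: exprn_continuous|exact: cvg_cst].
  exact: continuous_expR.
- exact: F0.
- by move=> x _; have [] := dF x.
- by apply: cvg_at_right_filter; exact: cF.
- by move=> x _; rewrite derive1E; have [_ ->] := dF x.
Qed.

(** For [s != 0], the joint density of two independent centred normals with deviation [s], as a
    function of the squared radius [w] and set to 0 below [u]. *)
Let tail_density (s u w : R) : \bar R :=
  (normal_peak s ^+ 2 * expR (- w / (s ^+ 2 *+ 2)) *
   \1_[set w | u <= w] w)%:E.

Let measurable_tail_density s u : measurable_fun [set: R] (tail_density s u).
Proof.
apply/measurable_EFinP; apply: measurable_funM; last first.
  by apply: measurable_indic; rewrite -set_itvcy.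
apply: measurable_funM => //; apply: measurableT_comp => //.
exact: measurable_funM.
Qed.

Let tail_density_ge0 s u w : (0 <= tail_density s u w)%E.
Proof. by rewrite lee_fin !mulr_ge0 ?exprn_ge0 ?normal_peak_ge0 ?expR_ge0. Qed.

Let integral_tail_density s u : s != 0 -> 0 <= u ->
  (\int[mu]_w (`|w|%:E * tail_density s u (w ^+ 2)) =
   (2 * normal_peak s ^+ 2 * s ^+ 2 * expR (- u / (s ^+ 2 *+ 2)))%:E)%E.
Proof.
move=> s0 u0; pose a : R := Num.sqrt u.
have a0 : 0 <= a by exact: sqrtr_ge0.
have a2 : a ^+ 2 = u by rewrite sqr_sqrtr.
pose f (w : R) : R := w * expR (- w ^+ 2 / (s ^+ 2 *+ 2)) * \1_(`[a, +oo[) w.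
have ind (w : R) : \1_(`[a, +oo[) w = (a <= w)%R%:R :> R.
  by rewrite indicE; congr (nat_of_bool _)%:R; apply/idP/idP;
    rewrite inE/= in_itv/= andbT.
have f0 (w : R) : 0 <= f w.
  rewrite /f indicE; case: (boolP (w \in _)) => [|_]; last by rewrite mulr0.
  rewrite inE/= in_itv/= andbT => aw.
  by rewrite mulr1 mulr_ge0 ?expR_ge0// (le_trans a0).
have mf : measurable_fun [set: R] f.
  apply: measurable_funM; last exact: measurable_indic.
  apply: measurable_funM => //; apply: measurableT_comp => //.
  by apply: measurable_funM => //; exact: measurableT_comp.
have If : (\int[mu]_w (f w)%:E =
    (s ^+ 2 * expR (- u / (s ^+ 2 *+ 2)))%:E)%E.
  rewrite -a2 -integral_Mexp_sqr// [RHS]integral_mkcond epatch_indic.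
  by apply: eq_integral => w _.
(* The even integrand is split into its two half-lines, which produces the factor 2. Nothing is
   counted twice at [w = 0], where [f] vanishes. *)
transitivity (\int[mu]_w ((normal_peak s ^+ 2)%:E *
    ((f w)%:E + (f (- w))%:E)))%E.
  apply: eq_integral => w _; rewrite /tail_density -EFinD -!EFinM; congr EFin.
  have uw : \1_[set w | u <= w] (w ^+ 2) = (a <= `|w|)%R%:R :> R.
    rewrite indicE; congr (nat_of_bool _)%:R; rewrite -[RHS]ler_sqr ?nnegrE//.
    by rewrite a2 real_normK ?num_real//; apply/idP/idP; rewrite inE.
  rewrite uw /f sqrrN !ind; have [w0|w0|->] := ltgtP w 0.
  - by rewrite ltr0_norm// (lt_geF (lt_le_trans w0 a0)) /=; ring.
  - by rewrite gtr0_norm// (@lt_geF _ _ (- w)) ?(lt_le_trans _ a0) ?oppr_lt0//=;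
      ring.
  - by rewrite normr0 oppr0 !mul0r addr0 mulr0.
rewrite ge0_integralZl//; last 3 first.
- apply/measurable_EFinP/measurable_funD => //; exact: measurableT_comp.
- by move=> w _; rewrite adde_ge0// lee_fin.
- by rewrite lee_fin exprn_ge0// normal_peak_ge0.
rewrite ge0_integralD//; last 4 first.
- by move=> w _; rewrite lee_fin.
- exact/measurable_EFinP.
- by move=> w _; rewrite lee_fin.
- by apply/measurable_EFinP; exact: measurableT_comp.
have -> : (\int[mu]_w (f (- w))%:E = \int[mu]_w (f w)%:E)%E.
  rewrite [RHS](@ge0_integral_affine _ (-1) 0)//; last exact/measurable_EFinP.
  rewrite normrN1 mul1e; apply: eq_integral => w _.
  by rewrite mulN1r addr0.
by rewrite If -EFinD -EFinM; congr EFin; ring.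
Qed.

(* The constant factor, including the integral of [1 / (1 + t ^+ 2)], is
   identified by the case [u = 0], where the total mass is 1. *)
Lemma normal_prob_radial (s u : R) : s != 0 -> 0 <= u ->
  (normal_prob 0 s \x normal_prob 0 s)%E [set y | u <= y.1 ^+ 2 + y.2 ^+ 2] =
  (expR (- u / (s ^+ 2 *+ 2)))%:E.
Proof.
move=> s0 u0.
have pdfE (x y : R) : normal_pdf 0 s y * normal_pdf 0 s x =
    normal_peak s ^+ 2 * expR (- (x ^+ 2 + y ^+ 2) / (s ^+ 2 *+ 2)).
  rewrite !normal_pdfE// /normal_fun !subr0 mulrACA -expRD -expr2.
  by congr (_ * expR _); rewrite -mulrDl; congr (_ / _); ring.
have E v : 0 <= v ->
    (normal_prob 0 s \x normal_prob 0 s)%E [set y | v <= y.1 ^+ 2 + y.2 ^+ 2] =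
    ((2 * normal_peak s ^+ 2 * s ^+ 2 * expR (- v / (s ^+ 2 *+ 2)))%:E *
     \int[mu]_t ((1 + t ^+ 2)^-1)%:E)%E.
  move=> v0; rewrite -integral_tail_density// -ge0_integral_radial//.
  have mS : measurable [set y : R * R | v <= y.1 ^+ 2 + y.2 ^+ 2].
    rewrite -[X in measurable X]setTI.
    have : measurable_fun [set: R * R] (fun y : R * R => y.1 ^+ 2 + y.2 ^+ 2).
      by apply: measurable_funD; exact: measurable_funX.
    by move=> /(_ measurableT [set w | v <= w]); apply; rewrite -set_itvcy.
  rewrite /product_measure1 integral_normal_prob//; last first.
    exact: measurable_fun_xsection.
  apply: eq_integral => x _ /=.
  rewrite normal_probE -ge0_integralZr//; last 3 first.
  - apply/measurable_EFinP/measurable_funM; first exact: measurable_normal_pdf.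
    by apply: measurable_indic; exact: measurable_xsection.
  - by move=> y _; rewrite mule_ge0// lee_fin normal_pdf_ge0.
  - by rewrite lee_fin normal_pdf_ge0.
  apply: eq_integral => y _; rewrite /tail_density -!EFinM; congr EFin.
  rewrite mulrAC pdfE; congr (_ * _).
  by rewrite !indicE; congr (nat_of_bool _)%:R; apply/idP/idP;
    rewrite /xsection !inE/= ?inE.
have E0 := E 0 (lexx 0).
have S1 : (normal_prob 0 s \x normal_prob 0 s)%E
    [set y | 0 <= y.1 ^+ 2 + y.2 ^+ 2] = 1%E.
  rewrite (_ : [set y | _] = setT); first exact: probability_setT.
  by apply/seteqP; split => // y _ /=; rewrite addr_ge0 ?sqr_ge0.
rewrite S1 oppr0 mul0r expR0 mulr1 in E0.
by rewrite E// mulrC EFinM -muleA -E0 mule1.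
Qed.

End gaussian_radius.

(** * Joint laws of independent variables and of complex normal coordinates *)

Section joint_law.
Context d (T : measurableType d) (R : realType) (P : probability T R).

(** Independence says that the law of the pair agrees with the product measure on rectangles, and
    this determines it. *)
Lemma independent_joint d1 d2 (T1 : measurableType d1) (T2 : measurableType d2)
    (X : T -> T1) (Y : T -> T2)
    (m1 : {sigma_finite_measure set T1 -> \bar R})
    (m2 : {sigma_finite_measure set T2 -> \bar R}) (C : set (T1 * T2)) :
  measurable_fun [set: T] X -> measurable_fun [set: T] Y ->
  independent P X Y ->
  (forall A, measurable A -> P (X @^-1` A) = m1 A) ->
  (forall B, measurable B -> P (Y @^-1` B) = m2 B) ->
  measurable C -> P [set t | C (X t, Y t)] = (m1 \x m2)%E C.
Proof.
move=> mX mY indep PX PY mC.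
have mXY : measurable_fun [set: T] (fun t => (X t, Y t)).
  exact: measurable_fun_pair.
pose m := pushforward P (fun t => (X t, Y t)) :
  {measure set (T1 * T2) -> \bar R}.
rewrite (@product_measure_unique _ _ _ _ _ m1 m2 (m mXY))// => A B mA mB.
by rewrite -PX// -PY// -indep.
Qed.

Lemma measurable_Re : measurable_fun [set: R[i]] (@complex.Re R).
Proof. by move=> _ A mA; apply: sub_sigma_algebra; left; exists A. Qed.

Lemma measurable_Im : measurable_fun [set: R[i]] (@complex.Im R).
Proof. by move=> _ A mA; apply: sub_sigma_algebra; right; exists A. Qed.

(** Positivity of [s] rules out the Dirac branch of [is_normal]. *)
Lemma complex_normal_joint (s : R) (X : {RV P >-> R[i]}) (C : set (R * R)) :
  0 < s -> is_complex_normal s X -> measurable C ->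
  P [set t | C (complex.Re (X t), complex.Im (X t))] =
  (normal_prob 0 (Num.sqrt (s / 2)) \x normal_prob 0 (Num.sqrt (s / 2)))%E C.
Proof.
move=> s0 [[_ XRe] [_ XIm] indep] mC.
have s20 : (s / 2 == 0) = false by apply: gt_eqF; rewrite divr_gt0.
apply: independent_joint => //.
- by apply: measurableT_comp => //; exact: measurable_Re.
- by apply: measurableT_comp => //; exact: measurable_Im.
- by move=> A mA; rewrite XRe// s20.
- by move=> A mA; rewrite XIm// s20.
Qed.

End joint_law.

(* Packed as a subprobability because [\x] alone is not recognized as a
   sigma-finite measure. *)
Definition plane_normal {R : realType} (s : R) :
    subprobability (measurableTypeR R * measurableTypeR R)%type R :=
  product_subprobability
    ((normal_prob 0 s : subprobability (measurableTypeR R) R),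
     (normal_prob 0 s : subprobability (measurableTypeR R) R)).

(** * The probability that adding the error shortens the estimate *)

Section gaussian_error.
Context (R : realType).
Local Notation mu := (@lebesgue_measure R).
Variables (sx sy : R).
Hypotheses (sx0 : 0 < sx) (sy0 : 0 < sy).

Local Notation Nx := (normal_prob 0 sx).
Local Notation p := (plane_normal sy).
Local Notation q := (plane_normal sx).
(** Chosen so that [1 / (r * sx) ^+ 2 = 1 / sx ^+ 2 + 4 / sy ^+ 2]: multiplying the density of [Nx]
    by the tail probability of the radius shrinks the deviation by [r]. *)
Let r := sy / Num.sqrt (sy ^+ 2 + 4 * sx ^+ 2).

Let sx_neq0 : sx != 0. Proof. by rewrite gt_eqF. Qed.
Let sy_neq0 : sy != 0. Proof. by rewrite gt_eqF. Qed.

(** The inner product with [y] has the law of [k * z], where [k] is the length of [y] and [z] has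
    law [Nx]. Dividing by [k] gives [z < - k / 2], rewritten without the square root. *)
Let half_plane (y1 y2 : R) : y2 != 0 ->
  q [set x | 2 * (x.1 * y1 + x.2 * y2) + (y1 ^+ 2 + y2 ^+ 2) < 0] =
  Nx [set z | z < 0 /\ y1 ^+ 2 + y2 ^+ 2 < 4 * z ^+ 2].
Proof.
move=> y20; set w := _ + _ ^+ 2.
have w0 : 0 < w by rewrite ltr_wpDl ?sqr_ge0// exprn_even_gt0.
have k0 : 0 < Num.sqrt w by rewrite sqrtr_gt0.
have kw : Num.sqrt w ^+ 2 = w by rewrite sqr_sqrtr ?ltW.
set k := Num.sqrt w in k0 kw.
have mA : measurable [set u : R | u < - w / 2] by rewrite -set_itvNyo.
have := @normal_prob_lincomb R sx y1 y2 _ sx_neq0 y20 mA.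
have := @normal_prob_affine R 0 sx k 0 _ (lt0r_neq0 k0) sx_neq0 mA.
rewrite mulr0 addr0 -/w -/k => <- qE.
transitivity (q [set x | y1 * x.1 + y2 * x.2 < - w / 2]).
  by congr (q _); apply/seteqP; split => x /= h; lra.
rewrite [LHS]qE; congr normal_prob; apply/seteqP; split => z /=; rewrite addr0.
  move=> h.
  have hz : z < - (k / 2).
    rewrite -(ltr_pM2l k0); apply: (lt_le_trans h).
    by rewrite -kw; lra.
  (* The product of these two positive factors is [4 * z ^+ 2 - k ^+ 2]. *)
  have := @mulr_gt0 _ (- 2 * z - k) (- 2 * z + k).
  have h1 : 0 < - 2 * z - k by lra.
  have h2 : 0 < - 2 * z + k by lra.
  by move=> /(_ h1 h2); rewrite -kw; split; lra.
move=> [z0]; rewrite -kw => h.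
have : k < - 2 * z.
  by rewrite -ltr_sqr ?nnegrE; [lra|exact: ltW|lra].
rewrite -subr_gt0 => /(mulr_gt0 k0); lra.
Qed.

(** The exponential weight times the density of [Nx] is [r] times the normal density of deviation
    [r * sx], half of whose mass lies on the negative side. *)
Let integral_lt0 : (\int[Nx]_z ((expR (- (4 * z ^+ 2) / (sy ^+ 2 *+ 2)))%:E *
   (\1_[set z : R | z < 0] z)%:E) = (1 / 2 * r)%:E)%E.
Proof.
have q0 : 0 < sy ^+ 2 + 4 * sx ^+ 2.
  by rewrite addr_gt0 ?mulr_gt0// exprn_gt0.
have rt0 : 0 < Num.sqrt (sy ^+ 2 + 4 * sx ^+ 2) by rewrite sqrtr_gt0.
have r0 : 0 < r by rewrite divr_gt0.
have r2 : r ^+ 2 = sy ^+ 2 / (sy ^+ 2 + 4 * sx ^+ 2).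
  by rewrite expr_div_n sqr_sqrtr// ltW.
have rsx0 : r * sx != 0 by rewrite mulf_neq0// gt_eqF.
rewrite integral_normal_prob; last 2 first.
- apply: emeasurable_funM; apply/measurable_EFinP.
    apply: measurableT_comp => //; apply: measurable_funM => //.
    by apply: measurableT_comp => //; apply: measurable_funM.
  by apply: measurable_indic; rewrite -set_itvNyo.
- by move=> z; rewrite mule_ge0// lee_fin ?expR_ge0.
have pdfE (z : R) : expR (- (4 * z ^+ 2) / (sy ^+ 2 *+ 2)) * normal_pdf 0 sx z =
    r * normal_pdf 0 (r * sx) z.
  rewrite !normal_pdfE// /normal_fun !subr0.
  rewrite -(@normal_peakM _ r sx) ?gt_eqF// (gtr0_norm r0).
  rewrite mulrCA -expRD [RHS]mulrA; congr (_ * expR _).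
  rewrite exprMn r2; field.
  by rewrite sx_neq0 sy_neq0 gt_eqF.
transitivity (\int[mu]_z (r%:E *
    ((normal_pdf 0 (r * sx) z)%:E * (\1_[set z : R | (z < 0)%R] z)%:E)))%E.
  apply: eq_integral => z _; rewrite -!EFinM; congr EFin.
  by rewrite mulrAC pdfE mulrA.
rewrite ge0_integralZl//; last 3 first.
- apply/measurable_EFinP/measurable_funM; first exact: measurable_normal_pdf.
  by apply: measurable_indic; rewrite -set_itvNyo.
- by move=> z _; rewrite mule_ge0// lee_fin normal_pdf_ge0.
- by rewrite lee_fin ltW.
by rewrite -normal_probE normal_prob_lt0// -EFinM mulrC.
Qed.

Let measurable_radius : measurable_fun [set: R * R]
  (fun y : R * R => y.1 ^+ 2 + y.2 ^+ 2).
Proof. by apply: measurable_funD; exact: measurable_funX. Qed.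

(** In [D] and [D'] an error vector is paired with a scalar normal; together they fill the
    half-space where the scalar is negative. In [S] the error comes first, so that [xsection] fixes
    it. *)
Let D := [set yz : (R * R) * R |
  yz.2 < 0 /\ yz.1.1 ^+ 2 + yz.1.2 ^+ 2 < 4 * yz.2 ^+ 2].
Let D' := [set yz : (R * R) * R |
  yz.2 < 0 /\ 4 * yz.2 ^+ 2 <= yz.1.1 ^+ 2 + yz.1.2 ^+ 2].
Let S := [set yx : (R * R) * (R * R) |
  2 * (yx.2.1 * yx.1.1 + yx.2.2 * yx.1.2) +
  (yx.1.1 ^+ 2 + yx.1.2 ^+ 2) < 0].

Let mlt0 : measurable [set yz : (R * R) * R | yz.2 < 0].
Proof.
rewrite -[X in measurable X]setTI.
have := @measurable_snd _ _ (R * R)%type R.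
by move=> /(_ measurableT [set z | z < 0]); apply; rewrite -set_itvNyo.
Qed.

Let g (yz : (R * R) * R) : R :=
  yz.1.1 ^+ 2 + yz.1.2 ^+ 2 - 4 * yz.2 ^+ 2.

Let mg : measurable_fun [set: (R * R) * R] g.
Proof.
apply: measurable_funB; first exact: (measurableT_comp measurable_radius).
by apply: measurable_funM => //; exact: measurable_funX.
Qed.

Let mD : measurable D.
Proof.
rewrite (_ : D = [set yz | yz.2 < 0] `&` g @^-1` `]-oo, 0[).
  by apply: measurableI => //; rewrite -[X in measurable X]setTI; exact: mg.
by apply/seteqP; split => z /=; rewrite in_itv/= /g subr_lt0.
Qed.

Let mD' : measurable D'.
Proof.
rewrite (_ : D' = [set yz | yz.2 < 0] `&` g @^-1` `[0, +oo[).
  by apply: measurableI => //; rewrite -[X in measurable X]setTI; exact: mg.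
by apply/seteqP; split => z /=; rewrite in_itv/= andbT /g subr_ge0.
Qed.

Lemma measurable_error_event : measurable S.
Proof.
have mf : measurable_fun [set: (R * R) * (R * R)]
    (fun yx : (R * R) * (R * R) =>
      2 * (yx.2.1 * yx.1.1 + yx.2.2 * yx.1.2) +
      (yx.1.1 ^+ 2 + yx.1.2 ^+ 2)).
  apply: measurable_funD; last exact: (measurableT_comp measurable_radius).
  apply: measurable_funM => //.
  by apply: measurable_funD; apply: measurable_funM; exact: measurableT_comp.
rewrite -[X in measurable X]setTI.
rewrite (_ : S = (fun yx : (R * R) * (R * R) =>
      2 * (yx.2.1 * yx.1.1 + yx.2.2 * yx.1.2) +
      (yx.1.1 ^+ 2 + yx.1.2 ^+ 2)) @^-1` `]-oo, 0[).
  exact: mf.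
by apply/seteqP; split => z /=; rewrite in_itv.
Qed.

(** By [half_plane], the sections of [S] and [D] at an error [y] have equal probability off the line
    [y.2 = 0], which is null for [p]. *)
Let error_event_half : (p \x q)%E S = (p \x Nx)%E D.
Proof.
have mSx : measurable_fun [set: R * R] (q \o xsection S).
  exact: (measurable_fun_xsection q measurable_error_event).
have mDx : measurable_fun [set: R * R] (Nx \o xsection D).
  exact: (measurable_fun_xsection
    (Nx : probability (measurableTypeR R) R) mD).
apply: ge0_ae_eq_integral => //.
exists [set y | y.2 = 0]; split.
- rewrite -[X in measurable X]setTI.
  exact: (@measurable_snd _ _ R R measurableT [set 0]).
- rewrite (_ : [set y | y.2 = 0] = setT `*` [set 0]); last first.
    by apply/seteqP; split => y /= => [|[]].
  rewrite [LHS]product_measure1E//.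
  by rewrite [X in (_ * X)%E](normal_prob_set1 R 0 sy 0) mule0.
- move=> y /= /not_implyP[_]; apply: contra_notP => /eqP y0.
  rewrite (_ : xsection S y = [set x | 2 * (x.1 * y.1 + x.2 * y.2) +
    (y.1 ^+ 2 + y.2 ^+ 2) < 0]); last first.
    by apply/seteqP; split => x; rewrite /xsection/= inE.
  rewrite half_plane//; congr normal_prob.
  by apply/seteqP; split => x; rewrite /xsection/= inE.
Qed.

(** For [z < 0] the section is the outside of the open disc of radius [- 2 * z], measured by
    [normal_prob_radial]; otherwise it is empty. *)
Let ysection_upper (z : R) : p (ysection D' z) =
  ((expR (- (4 * z ^+ 2) / (sy ^+ 2 *+ 2)))%:E *
   (\1_[set z | (z < 0)%R] z)%:E)%E.
Proof.
have z2 : 0 <= 4 * z ^+ 2 by rewrite mulr_ge0// sqr_ge0.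
rewrite indicE; have [z0|z0] := ltP z 0.
  rewrite mem_set// mule1.
  rewrite (_ : ysection D' z = [set y | 4 * z ^+ 2 <= y.1 ^+ 2 + y.2 ^+ 2]).
    exact: normal_prob_radial sy_neq0 z2.
  apply/seteqP; split => y; rewrite /ysection/= inE/=; first by case.
  by split.
rewrite memNset ?mule0; last by apply/negP; rewrite -leNgt.
rewrite (_ : ysection D' z = set0); first exact: measure0.
apply/seteqP; split => y //; rewrite /ysection/= inE => -[/= zlt0 _].
by move: z0; rewrite leNgt zlt0.
Qed.

Let upper_event : (p \x Nx)%E D' = (1 / 2 * r)%:E.
Proof.
rewrite -integral_lt0.
(* The product measure is re-expressed with the scalar [z] as the outer variable: this is the
   exchange of roles. *)
transitivity ((p \x^ Nx)%E D').
  apply: product_measure_unique => // A B mA mB; exact: product_measure2E.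
by apply: eq_integral => z _; exact: ysection_upper.
Qed.

(** [D] and [D'] are disjoint with total mass 1/2, so the mass of [D] follows from that of [D']. *)
Lemma gaussian_error_prob : (p \x q)%E S = (1 / 2 * (1 - r))%:E.
Proof.
rewrite error_event_half.
have sub (z : \bar R) (a b : R) : (z + a%:E = b%:E -> z = (b - a)%:E)%E.
  by case: z => [z [<-]|//|//]; rewrite addrK.
have : (p \x Nx)%E (D `|` D') = (1 / 2)%:E.
  rewrite (_ : D `|` D' = setT `*` [set z | z < 0]).
    rewrite product_measure1E//; last by rewrite -set_itvNyo.
    rewrite [X in (_ * X)%E]normal_prob_lt0// -[X in (X * _)%E]/(p setT).
    (* Since [p] is packed only as a subprobability, its total mass 1 is recovered from its two
       factors. *)
    rewrite -setXTT [X in (X * _)%E]product_measure1E//.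
    by rewrite [X in (X * X * _)%E](@probability_setT _ _ _
      (normal_prob 0 sy : probability (measurableTypeR R) R)) !mul1e.
  apply/seteqP; split => -[y z]/=; first by move=> [[]|[]].
  move=> [_ z0].
  by have [h|h] := ltP (y.1 ^+ 2 + y.2 ^+ 2) (4 * z ^+ 2); [left|right].
rewrite measureU//; last first.
  by apply/seteqP; split => // -[y z] /= [[_ h] [_]]; rewrite leNgt h.
rewrite [X in (_ + X)%E]upper_event.
by move=> /sub ->; congr EFin; ring.
Qed.

End gaussian_error.

(** * Comparison of rate and capacity as a quadratic inequality *)

Section rate_capacity.
Context (R : realType).

Lemma ltr_log2 (x y : R) : 0 < x -> 0 < y -> (log2 x < log2 y) = (x < y).
Proof.
by move=> x0 y0; rewrite ltr_pM2r ?invr_gt0 ?ln_gt0 ?ltr1n// ltr_ln ?posrE.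
Qed.

Lemma sqr_normc (z : R[i]) :
  Normc.normc z ^+ 2 = complex.Re z ^+ 2 + complex.Im z ^+ 2.
Proof. by case: z => a b /=; rewrite sqr_sqrtr// addr_ge0 ?sqr_ge0. Qed.

(** By monotonicity of the logarithm only the squared moduli matter, and the new condition is the
    expansion of their difference. *)
Lemma lt_log2_normcD (rho W : R) (z e : R[i]) : 0 < rho -> 0 < W ->
  (W * log2 (1 + rho * Normc.normc (z + e) ^+ 2) <
   W * log2 (1 + rho * Normc.normc z ^+ 2)) =
  (2 * (complex.Re z * complex.Re e + complex.Im z * complex.Im e) +
   (complex.Re e ^+ 2 + complex.Im e ^+ 2) < 0).
Proof.
move=> rho0 W0.
have pos (w : R[i]) : 0 < 1 + rho * Normc.normc w ^+ 2.
  by rewrite ltr_pwDl// mulr_ge0 ?sqr_ge0// ltW.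
rewrite ltr_pM2l// ltr_log2// ltrD2l ltr_pM2l// !sqr_normc -subr_lt0.
by case: z e => [a b] [a' b'] /=; congr (_ < 0); ring.
Qed.

End rate_capacity.

(** * Application to the pilot-based channel estimate *)

Theorem proposition1 (d : measure_display) (T : measurableType d)
    (R : realType) (P : probability T R)
    (rho : R) (L : nat) (W : R) (hhat htilde : {RV P >-> R[i]}) :
  let sigmaE2 : R := 1 / (1 + rho * L%:R) in
  let sigmaE : R := Num.sqrt sigmaE2 in
  let h (t : T) : R[i] := hhat t + htilde t in
  let capacity (t : T) : R := W * log2 (1 + rho * Normc.normc (h t) ^+ 2) in
  let rate (t : T) : R := W * log2 (1 + rho * Normc.normc (hhat t) ^+ 2) in
  0 < rho -> (1 <= L)%N -> 0 < W ->
  is_complex_normal (1 - sigmaE2) hhat ->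
  is_complex_normal sigmaE2 htilde ->
  independent P hhat htilde ->
  P [set t | rate t > capacity t] =
    (1 / 2 * (1 - sigmaE / Num.sqrt (4 - 3 * sigmaE2)))%:E.
Proof.
move=> sigmaE2 sigmaE h capacity rate rho0 L1 W0 hhatN htildeN indep.
have rL0 : 0 < rho * L%:R by rewrite mulr_gt0// ltr0n.
have s2_gt0 : 0 < sigmaE2 by rewrite divr_gt0// addr_gt0.
(* At least one pilot makes the variance of the estimate positive, so neither complex law is
   degenerate. *)
have s2_lt1 : sigmaE2 < 1 by rewrite ltr_pdivrMr ?addr_gt0// mul1r ltrDl.
have a0 : 0 < 1 - sigmaE2 by rewrite subr_gt0.
pose sx := Num.sqrt ((1 - sigmaE2) / 2).
pose sy := Num.sqrt (sigmaE2 / 2).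
have sx0 : 0 < sx by rewrite sqrtr_gt0 divr_gt0.
have sy0 : 0 < sy by rewrite sqrtr_gt0 divr_gt0.
have sx2 : sx ^+ 2 = (1 - sigmaE2) / 2 by rewrite sqr_sqrtr// divr_ge0// ltW.
have sy2 : sy ^+ 2 = sigmaE2 / 2.
  by rewrite sqr_sqrtr// mulr_ge0 ?invr_ge0// (ltW s2_gt0).
pose coord (z : R[i]) : measurableTypeR R * measurableTypeR R :=
  (complex.Re z, complex.Im z).
have mcoord : measurable_fun [set: R[i]] coord.
  by apply: measurable_fun_pair; [exact: measurable_Re|exact: measurable_Im].
have mcoordX (X : {RV P >-> R[i]}) : measurable_fun [set: T] (coord \o X).
  exact: (measurableT_comp mcoord (measurable_funPT X)).
(* The order is reversed here because the error is the first component in the failure event. *)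
have coord_indep : independent P (coord \o htilde) (coord \o hhat).
  have mpre A : measurable A -> measurable (coord @^-1` A).
    by move=> mA; rewrite -[X in measurable X]setTI; exact: mcoord.
  move=> A B mA mB; rewrite setIC muleC.
  exact: (indep _ _ (mpre B mB) (mpre A mA)).
have := @independent_joint _ _ _ P _ _ _ _ (coord \o htilde) (coord \o hhat)
  (plane_normal sy) (plane_normal sx) _ _ _ coord_indep _ _
  (measurable_error_event R).
move=> jointE.
transitivity (P [set t | [set yx : (R * R) * (R * R) |
    2 * (yx.2.1 * yx.1.1 + yx.2.2 * yx.1.2) +
    (yx.1.1 ^+ 2 + yx.1.2 ^+ 2) < 0] (coord (htilde t), coord (hhat t))]).
  by congr (P _); apply/seteqP; split => t /=;
    rewrite /rate /capacity /h lt_log2_normcD.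
rewrite jointE.
- rewrite gaussian_error_prob//; congr (1 / 2 * (1 - _))%:E.
  rewrite sx2 sy2.
  (* The halves coming from the split into real and imaginary parts then cancel in the ratio of
     square roots. *)
  have -> : sigmaE2 / 2 + 4 * ((1 - sigmaE2) / 2) = (4 - 3 * sigmaE2) / 2.
    by field.
  have s4 : 0 <= 4 - 3 * sigmaE2 by lra.
  rewrite /sy (sqrtrM _ (ltW s2_gt0)) (sqrtrM _ s4).
  by rewrite -mulf_div divff ?mulr1// gt_eqF// sqrtr_gt0 invr_gt0.
- exact: mcoordX.
- exact: mcoordX.
- by move=> A mA; apply: complex_normal_joint htildeN mA.
- by move=> A mA; apply: complex_normal_joint hhatN mA.
Qed.
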